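(* For all $\alpha\in(1,2)$ and all integers $k\ge3$ and $r\ge1$, we have $L_{\alpha,k,r}(x)=O_{\alpha,k,r}(x^{2-\alpha})$ as $x\to\infty$; that is, there is a constant $C>0$ depending only on $\alpha,k,r$ such that $L_{\alpha,k,r}(x)\le Cx^{2-\alpha}$ for all sufficiently large $x$.
   Context: For $\alpha\in(1,2)$, real $x\ge1$, and integers $k\ge3$, $r\ge1$, $$L_{\alpha,k,r}(x)=\min\{y\ge0 : \exists n\in[x,x+y]\cap\mathbb{Z},\ (\lfloor (n+rj)^\alpha\rfloor)_{j=0}^{k-1}\in\mathcal{P}_{k,1}\},$$ where $\lfloor\cdot\rfloor$ is the floor function and $\mathcal{P}_{k,1}$ is the set of all strictly increasing arithmetic progressions $(a(n))_{n=0}^{k-1}$ of length $k$ in the positive integers. *)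

(* Defs.v *)
From mathcomp Require Import all_boot all_order all_algebra.
From mathcomp Require Import all_classical all_reals all_analysis.
Set Implicit Arguments.
Unset Strict Implicit.
Unset Printing Implicit Defensive.
Import Order.TTheory GRing.Theory Num.Theory.
Import numFieldNormedType.Exports.
Local Open Scope classical_set_scope.
Local Open Scope ring_scope.

Definition increasing_AP (k : nat) : set ('I_k -> int) :=
  [set a | exists b d : int,
     [/\ 0 < b, 0 < d & forall j : 'I_k, a j = b + d * (j : nat)%:Z]].

Definition floor_powers (R : realType) (alpha : R) (k r : nat) (n : int) :
    'I_k -> int :=
  fun j => Num.floor ((n%:~R + (r * j)%N%:R) `^ alpha).

Definition AP_gaps (R : realType) (alpha : R) (k r : nat) (x : R) : set R :=
  [set y | 0 <= y /\
     exists n : int, x <= n%:~R <= x + y /\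
       increasing_AP (floor_powers alpha (k := k) r n)].

Definition is_min (R : realType) (S : set R) (m : R) : Prop :=
  S m /\ lbound S m.

(* L_{alpha,k,r}(x) = l.  The minimum is given as a relation because the set
   of admissible y is not known in advance to be nonempty: asserting
   [is_L alpha k r x l] includes that the minimum exists (it is then unique). *)
Definition is_L (R : realType) (alpha : R) (k r : nat) (x l : R) : Prop :=
  is_min (AP_gaps alpha k r x) l.

(* Main.v *)
Require Import Defs.
From mathcomp Require Import all_boot all_order all_algebra.
From mathcomp Require Import all_classical all_reals all_analysis.
From mathcomp Require Import ring lra.
Import Order.TTheory GRing.Theory Num.Theory.
Import numFieldNormedType.Exports.
Local Open Scope classical_set_scope.
Local Open Scope ring_scope.

(** Along a progression of step r, the sequence h i = (N + r i)^alpha has small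
    and slowly varying convexity: by the mean value theorem its second
    differences lie between c and 2 c as long as N + r i stays in [x, 2 x], where
    c = r^2 alpha (alpha - 1) (2 x)^(alpha - 2) tends to 0 with x.  What is left
    is a fact about real sequences whose second differences lie in [c, 2 c]
    ([floor_AP_of_second_differences]).

    The first differences of h grow by at least c at each step, so they pass an
    integer d after at most about 1/c steps; and as they grow by at most 2 c,
    they then stay in [d, d + 1/k] for about 1/(4 k c) further steps.  On this
    window h i - d i is nondecreasing with steps at most 1/k, and by convexity
    its total growth there is of order c (1/c)^2 = 1/c, hence more than 1.  It
    therefore crosses an integer, and because it moves by at most 1/k per step,
    its floor is constant during the k steps that follow the crossing
    ([floor_plateau]).  There the floors of h form an arithmetic progression of
    difference d.

    The search ends within 4/c steps of length r, that is, within a distance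
    O(x^(2 - alpha)) of x.  As 2 - alpha < 1, this distance is at most x / 2
    for large x, so the search never leaves [x, 2 x]. *)

(** * Integer crossings of slowly increasing sequences *)

(** The overshoot of the first crossing of the level c is less than one step;
    the bound on u 0 covers a crossing at index 0. *)
Lemma first_crossing (R : realType) (u : nat -> R) (c s : R) (n : nat) :
  u 0%N < c + s -> (forall i, (i < n)%N -> u i.+1 <= u i + s) -> c <= u n ->
  exists2 i, (i <= n)%N & c <= u i < c + s.
Proof.
move=> u0 us un.
have ex : exists i, c <= u i by exists n.
have [i ci min_i] := ex_minnP ex.
have le_in : (i <= n)%N by exact: min_i.
exists i => //; rewrite ci /=.
case: i ci min_i le_in => [//|i] ci min_i lt_in.
have ltc : u i < c by rewrite ltNge; apply/negP => /min_i; rewrite ltnn.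
by rewrite (le_lt_trans (us i lt_in)) // ltrD2r.
Qed.

Lemma increments_sum (R : realType) (u : nat -> R) (a b : R) (n : nat) :
  (forall i, (i < n)%N -> a <= u i.+1 - u i <= b) ->
  a * n%:R <= u n - u 0%N <= b * n%:R.
Proof.
elim: n => [|n IHn] ab; first by rewrite subrr !mulr0 lexx.
have /andP[le1 le2] := IHn (fun i lt_in => ab i (ltnW lt_in)).
have /andP[le3 le4] := ab n (ltnSn n).
by rewrite -natr1 !mulrDr !mulr1; apply/andP; split; lra.
Qed.

(** After the first crossing of an integer m, at height less than m + 1/k, the
    remaining k - 1 steps of size at most 1/k cannot reach m + 1. *)
Lemma floor_plateau (R : realType) (g : nat -> R) (k W : nat) :
  (0 < k)%N ->
  (forall i, (i < W + k)%N -> 0 <= g i.+1 - g i <= k%:R^-1) ->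
  g 0%N + 1 <= g W ->
  exists t (m : int), (t <= W)%N /\
    forall j, (j < k)%N -> Num.floor (g (t + j)%N) = m.
Proof.
move=> k_gt0 gk gW.
have k0 : 0 < k%:R :> R by rewrite ltr0n.
set m := Num.floor (g 0%N) + 1.
have /andP[m0 m1] := floor_itv (g 0%N).
have mE : m%:~R = (Num.floor (g 0%N))%:~R + 1 :> R by rewrite /m intrD.
rewrite -/m in m1.
have [t tW /andP[mt tm]] : exists2 t, (t <= W)%N &
    m%:~R <= g t < m%:~R + k%:R^-1.
  apply: first_crossing.
  - by rewrite (lt_trans m1) // ltrDl invr_gt0.
  - move=> i iW; have /andP[_] := gk i (leq_trans iW (leq_addr _ _)).
    by rewrite lerBlDl.
  - by rewrite (le_trans _ gW) // mE lerD2r.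
exists t, m; split=> // j jk.
apply: floor_def; rewrite intrD.
have /andP[] : 0 * j%:R <= g (t + j)%N - g (t + 0)%N <= k%:R^-1 * j%:R.
  apply: (increments_sum R (fun i => g (t + i)%N)) => i ij.
  by rewrite addnS; apply: gk; rewrite -addnS leq_add // (leq_trans ij) // ltnW.
rewrite mul0r addn0 subr_ge0 => ge_t le_j.
rewrite (le_trans mt ge_t) /=.
have : k%:R^-1 * j%:R <= k%:R^-1 * (k%:R - 1) :> R.
  by rewrite ler_pM2l ?invr_gt0 // lerBrDr natr1 ler_nat.
rewrite mulrBr mulVf ?gt_eqF // mulr1 => le_k.
lra.
Qed.

(** First differences that grow linearly make the sequence itself grow
    quadratically; this is what beats the factor c when c is small. *)
Lemma convex_growth (R : realType) (g : nat -> R) (c : R) (n : nat) :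
  (forall i, (i < n)%N -> c * i%:R <= g i.+1 - g i) ->
  c * (n%:R * (n%:R - 1)) / 2 <= g n - g 0%N.
Proof.
elim: n => [|n IHn] gc; first by rewrite mul0r mulr0 mul0r subrr.
have le1 := IHn (fun i lt_in => gc i (ltnW lt_in)).
have le2 := gc n (ltnSn n).
by rewrite -natr1; lra.
Qed.

(** The sequence is compared with the lines of slope d, for d the least integer
    not below its first difference at 0: once the first differences reach d, the
    sequence leaves such a line so slowly that [floor_plateau] applies to the
    gap, whose floor being constant makes the floors of h an arithmetic
    progression. *)
Lemma floor_AP_of_second_differences (R : realType) (k : nat) (c : R)
    (h : nat -> R) :
  (0 < k)%N -> 0 < c -> 256 * k%:R ^+ 2 <= c^-1 ->
  (forall i, 1 <= h i) -> h 0%N < h 1%N ->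
  (forall i, i%:R <= 4 * c^-1 ->
     c <= (h i.+2 - h i.+1) - (h i.+1 - h i) <= 2 * c) ->
  exists2 i : nat, i%:R <= 4 * c^-1 &
    exists b d : int, [/\ 0 < b, 0 < d &
      forall j, (j < k)%N -> Num.floor (h (i + j)%N) = b + d * j%:Z].
Proof.
move=> k_gt0 c_gt0 c_small h1 h01 hc.
have k1 : 1 <= k%:R :> R by rewrite ler1n.
set q := c^-1 in c_small hc *.
have q_gt0 : 0 < q by rewrite invr_gt0.
have cq : c * q = 1 by rewrite mulfV ?gt_eqF.
have kk : k%:R <= k%:R ^+ 2 :> R by rewrite expr2 ler_peMr.
set D := fun i => h i.+1 - h i.
set d := Num.ceil (D 0%N).
have /andP[d1 d0] := ceil_itv (D 0%N); rewrite -/d intrB in d1 d0.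
have d_gt0 : 0 < d.
  by rewrite -(ltr_int R) (lt_le_trans _ d0) // /D subr_gt0.
set N := (Num.truncn q).+1.
have /andP[N0 N1] := truncn_itv (ltW q_gt0).
have NE : N%:R = (Num.truncn q)%:R + 1 :> R by rewrite /N -natr1.
rewrite -/N in N1.
(* The first differences stay within 1/k of d for p steps after reaching d:
   they gain at most 2 * c at each step, which makes half of 1/k in total and
   leaves the other half for the k steps that follow the crossing. *)
set p := q / (4 * k%:R).
have pk : p * k%:R = q / 4 by rewrite /p; field; rewrite gt_eqF // (lt_le_trans _ k1).
have p_big : 64 * k%:R <= p.
  rewrite -(@ler_pM2r _ k%:R) ?pk ?(lt_le_trans _ k1) //; nra.
have p_ge0 : 0 <= p by lra.
set W := Num.truncn p.
have /andP[W0 W1] := truncn_itv p_ge0; rewrite -/W -natr1 in W0 W1.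
have pq : p <= q / 4 by rewrite -pk ler_peMr.
have idx i : (i <= N + W + k)%N -> i%:R <= 4 * q.
  by rewrite -(ler_nat R) !natrD => ?; lra.
have Dc i : (i <= N + W + k)%N -> c <= D i.+1 - D i <= 2 * c.
  by move=> /idx; exact: hc.
have [i0 i0N /andP[dD Dd]] : exists2 i, (i <= N)%N &
    d%:~R <= D i < d%:~R + 2 * c.
  apply: first_crossing.
  - by rewrite (le_lt_trans d0) // ltrDl mulr_gt0.
  - move=> i iN; have /andP[_] : c <= D i.+1 - D i <= 2 * c.
      by apply: Dc; rewrite -addnA (leq_trans (ltnW iN)) // leq_addr.
    by rewrite lerBlDl.
  - have /andP[+ _] : c * N%:R <= D N - D 0%N <= 2 * c * N%:R.
      apply: increments_sum => i iN.
      by apply: Dc; rewrite -addnA (leq_trans (ltnW iN)) // leq_addr.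
    have : c * q <= c * N%:R by rewrite ler_pM2l // ltW.
    lra.
have Dt t : (t <= W + k)%N ->
    d%:~R + c * t%:R <= D (i0 + t)%N <= d%:~R + 2 * c * (t%:R + 1).
  move=> tW.
  have /andP[] : c * t%:R <= D (i0 + t)%N - D (i0 + 0)%N <= 2 * c * t%:R.
    apply: (increments_sum R (fun i => D (i0 + i)%N)) => i it.
    rewrite addnS; apply: Dc; rewrite -addnA leq_add //.
    by rewrite (leq_trans (ltnW it)).
  rewrite addn0 => l1 l2; apply/andP; split; lra.
set g := fun t => h (i0 + t)%N - d%:~R * (i0 + t)%:R.
have gS t : g t.+1 - g t = D (i0 + t)%N - d%:~R.
  by rewrite /g /D addnS -natr1; ring.
have ck : c * k%:R <= 1 / 256.
  rewrite -(@ler_pM2l _ q) // mulrA [q * c]mulrC cq; nra.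
have [t [m [tW fg]]] : exists t (m : int), (t <= W)%N /\
    forall j, (j < k)%N -> Num.floor (g (t + j)%N) = m.
  apply: floor_plateau => //.
  - move=> i iW; rewrite gS.
    have /andP[l1 l2] := Dt i (ltnW iW).
    have ci : 0 <= c * i%:R by rewrite mulr_ge0 // ltW.
    apply/andP; split; first lra.
    have l3 : i%:R + 1 <= p + k%:R.
      rewrite natr1; apply: (@le_trans _ _ (W + k)%:R); first by rewrite ler_nat.
      by rewrite natrD lerD2r.
    have l4 : 2 * c * (i%:R + 1) <= 2 * c * (p + k%:R).
      by rewrite ler_pM2l // mulr_gt0.
    have l5 : 2 * c * (p + k%:R) <= k%:R^-1.
      rewrite -(@ler_pM2r _ k%:R) ?(lt_le_trans _ k1) //.
      rewrite mulVf ?gt_eqF ?(lt_le_trans _ k1) //.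
      have -> : 2 * c * (p + k%:R) * k%:R = 2 * c * (p * k%:R) + 2 * (c * k%:R ^+ 2) by ring.
      have -> : 2 * c * (p * k%:R) = c * q / 2 by rewrite pk; field.
      rewrite cq.
      have : c * k%:R ^+ 2 <= 1 / 256.
        rewrite -(@ler_pM2l _ q) // mulrA [q * c]mulrC cq; lra.
      lra.
    lra.
  - have : c * (W%:R * (W%:R - 1)) / 2 <= g W - g 0%N.
      apply: convex_growth => i iW; rewrite gS.
      have /andP[l1 _] := Dt i (leq_trans (ltnW iW) (leq_addr _ _)); lra.
    suff : 2 <= c * (W%:R * (W%:R - 1)) by lra.
    (* The smallness of c enters here: c * p is 1 / (4 k) and p >= 64 k, so that
       c * p^2 is at least 16, while W is p up to rounding. *)
    have W2 : p / 2 * (p / 2) <= W%:R * (W%:R - 1).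
      by apply: ler_pM; lra.
    have : c * (p / 2 * (p / 2)) <= c * (W%:R * (W%:R - 1)) by rewrite ler_pM2l.
    have cpk : c * p * k%:R = 1 / 4 by rewrite -mulrA pk mulrA cq.
    have : 64 * (k%:R * (c * p)) <= p * (c * p).
      by rewrite mulrA ler_wpM2r // mulr_ge0 // ltW.
    lra.
exists (i0 + t)%N.
  by apply: idx; rewrite -addnA (leq_trans (leq_add i0N tW)) // leq_add2l leq_addr.
have fh j : (j < k)%N -> Num.floor (h (i0 + t + j)%N) = m + d * (i0 + t + j)%:Z.
  move=> jk; have /andP[] := floor_itv (g (t + j)%N).
  rewrite fg // intrD /g addnA => l1 l2.
  by apply: floor_def; rewrite !intrD intrM -pmulrn; apply/andP; split; lra.
exists (m + d * (i0 + t)%:Z), d; split=> // [|j jk].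
  by rewrite -[(i0 + t)%N]addn0 -fh // floor_gt0.
by rewrite fh // PoszD mulrDr addrA.
Qed.

(** * Second differences of power functions *)

Lemma MVT_pos (R : realType) (f df : R -> R) (a b : R) :
  (forall t : R, 0 < t -> is_derive t 1 f (df t)) -> 0 < a -> a < b ->
  exists2 c, a < c < b & f b - f a = df c * (b - a).
Proof.
move=> fd a0 ab.
have [||c cab ->] := @MVT R f df a b ab.
- by move=> t; rewrite in_itv /= => /andP[at_ _]; apply: fd; exact: lt_trans at_.
- apply: derivable_within_continuous => t; rewrite in_itv /= => /andP[at_ _].
  by have [] := fd t (lt_le_trans a0 at_).
by exists c => //; move: cab; rewrite in_itv.
Qed.

(** The second difference is a first difference of t |-> (t + s)^p - t^p, whose
    derivative is itself a first difference of p t^(p - 1); this is why the mean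
    value theorem applies twice. *)
Lemma powR_second_difference (R : realType) (p u s : R) :
  0 < u -> 0 < s ->
  exists2 c, u < c < u + s + s &
    ((u + s + s) `^ p - (u + s) `^ p) - ((u + s) `^ p - u `^ p) =
    s ^+ 2 * (p * (p - 1)) * c `^ (p - 2).
Proof.
move=> u0 s0.
pose phi (t : R) := (t + s) `^ p - t `^ p.
have phid (t : R) : 0 < t ->
    is_derive t 1 phi (p * (t + s) `^ (p - 1) - p * t `^ (p - 1)).
  move=> t0.
  have d1 : is_derive t 1 (fun t : R => (t + s) `^ p) (p * (t + s) `^ (p - 1) * 1).
    apply: (@is_derive1_comp _ (fun z : R => z `^ p) (fun t : R => t + s)).
      by apply: is_derive1_powR; rewrite addr_gt0.
    by rewrite -[X in is_derive _ _ _ X]addr0; apply: is_deriveD.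
  rewrite -[p * (t + s) `^ (p - 1)]mulr1.
  by apply: is_deriveB; exact: is_derive1_powR.
have [|c1 /andP[uc1 c1u]] := MVT_pos R phi _ u (u + s) phid u0.
  by rewrite ltrDl.
rewrite /phi => ->; have -> : u + s - u = s by ring.
have c10 : 0 < c1 by exact: lt_trans uc1.
have powd (t : R) : 0 < t -> is_derive t 1 (fun t : R => t `^ (p - 1))
    ((p - 1) * t `^ (p - 1 - 1)) by exact: is_derive1_powR.
have [|c /andP[c1c cc1] E] := MVT_pos R _ _ c1 (c1 + s) powd c10.
  by rewrite ltrDl.
exists c; first by apply/andP; split; lra.
rewrite -mulrBr E.
have -> : c1 + s - c1 = s by ring.
have -> : p - 1 - 1 = p - 2 by ring.
ring.
Qed.

Lemma powR_double (R : realType) (x e : R) :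
  0 < x -> 0 <= e <= 1 -> x `^ e <= (2 * x) `^ e <= 2 * x `^ e.
Proof.
move=> x0 /andP[e0 e1].
have le12 : 1 <= 2 :> R by rewrite ler1n.
rewrite powRM ?(ltW x0) //; apply/andP; split.
  by rewrite ler_peMl ?powR_ge0 // -[leLHS](powRr0 2) ler_powR.
by rewrite ler_pM2r ?powR_gt0 // -[leRHS]powRr1 // ler_powR.
Qed.

(** The second derivative alpha (alpha - 1) t^(alpha - 2) varies by a factor
    2^(2 - alpha) <= 2 only over [x, 2 x]. *)
Lemma powR_second_difference_bounds (R : realType) (alpha x u s : R) :
  1 < alpha < 2 -> 0 < s -> 0 < x -> x <= u -> u + s + s <= 2 * x ->
  let c := s ^+ 2 * (alpha * (alpha - 1)) / (2 * x) `^ (2 - alpha) in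
  c <= ((u + s + s) `^ alpha - (u + s) `^ alpha)
       - ((u + s) `^ alpha - u `^ alpha) <= 2 * c.
Proof.
move=> /andP[alpha1 alpha2] s0 x0 xu us2x /=.
have e01 : 0 <= 2 - alpha <= 1 by apply/andP; split; lra.
have /andP[e0 _] := e01.
have /andP[_ double] := powR_double R x (2 - alpha) x0 e01.
have [t /andP[ut tu]] :=
  powR_second_difference R alpha u s (lt_le_trans x0 xu) s0.
move=> ->.
have xt : x <= t by rewrite (le_trans xu) // ltW.
have t0 : 0 < t by exact: lt_le_trans xt.
have t2x : t <= 2 * x by rewrite (le_trans _ us2x) // ltW.
have mono v w : 0 < v -> v <= w -> v `^ (2 - alpha) <= w `^ (2 - alpha).
  move=> v0 vw; apply: ge0_ler_powR => //; rewrite nnegrE ltW //.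
  exact: lt_le_trans vw.
have upper := mono t (2 * x) t0 t2x.
have lower := mono x t x0 xt.
have x20 : 0 < (2 * x) `^ (2 - alpha) by rewrite powR_gt0 // mulr_gt0.
have te0 : 0 < t `^ (2 - alpha) by rewrite powR_gt0.
have c0 : 0 < s ^+ 2 * (alpha * (alpha - 1)).
  by rewrite mulr_gt0 ?exprn_gt0 // mulr_gt0 ?subr_gt0 // (lt_trans _ alpha1).
have -> : t `^ (alpha - 2) = (t `^ (2 - alpha))^-1 by rewrite -powRN opprB.
apply/andP; split; first by rewrite ler_pM2l // lef_pV2 ?posrE.
rewrite [leRHS]mulrCA ler_pM2l // ler_pdivlMr // mulrC.
by rewrite ler_pdivrMr // (le_trans double) // ler_pM2l.
Qed.

(** * Reduction of the theorem to one admissible integer *)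

Lemma powR_near_ge (R : realType) (p M : R) :
  0 < p -> \forall x \near +oo, M <= x `^ p.
Proof.
move=> p0.
have m0 : 0 <= Num.max M 1 by rewrite le_max ler01 orbT.
near=> x.
rewrite (@le_trans _ _ (Num.max M 1)) ?le_max ?lexx //.
rewrite -[leLHS](@powRr1 _ _ m0) -(@mulVf _ p) ?gt_eqF // powRrM.
have Bx : Num.max M 1 `^ p^-1 <= x by near: x; exact: nbhs_pinfty_ge.
apply: ge0_ler_powR => //; first exact: ltW.
  by rewrite nnegrE powR_ge0.
by rewrite nnegrE (le_trans _ Bx) ?powR_ge0.
Unshelve. all: by end_near. Qed.

(** The minimum is attained because the admissible integers not below x are
    the integers Num.ceil x + m with m in a nonempty set of naturals, which has a
    least element. *)
Lemma is_L_le (R : realType) (alpha x : R) (k r : nat) (n : int) :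
  x <= n%:~R -> increasing_AP (floor_powers alpha (k := k) r n) ->
  exists l : R, is_L alpha k r x l /\ l <= n%:~R - x.
Proof.
pose P m := increasing_AP (floor_powers alpha (k := k) r (Num.ceil x + m%:Z)).
have offset i : x <= i%:~R -> exists m : nat, i = Num.ceil x + m%:Z.
  move=> xi; exists `|i - Num.ceil x|%N.
  rewrite gez0_abs; last by rewrite subr_ge0 ceil_le_int.
  ring.
move=> xn APn; have [m nE] := offset n xn.
have ex : exists m, `[< P m >] by exists m; apply/asboolP; rewrite /P -nE.
have [m0 /asboolP APm0 min_m0] := ex_minnP ex.
have le_min i : x <= i%:~R -> increasing_AP (floor_powers alpha (k := k) r i) ->
    (Num.ceil x + m0%:Z)%:~R <= i%:~R :> R.
  move=> xi APi; have [mi iE] := offset i xi.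
  by rewrite iE ler_int lerD2l lez_nat; apply: min_m0; apply/asboolP; rewrite /P -iE.
have xm0 : x <= (Num.ceil x + m0%:Z)%:~R.
  by rewrite (le_trans (ceil_ge x)) // ler_int lerDl.
exists ((Num.ceil x + m0%:Z)%:~R - x); split; last by rewrite lerD2r le_min.
split.
  split; first by rewrite subr_ge0.
  exists (Num.ceil x + m0%:Z); split=> //.
  by rewrite xm0 [x + _]addrC subrK lexx.
move=> y [_ [i [/andP[xi iy] APi]]].
by rewrite lerBlDl (le_trans _ iy) // le_min.
Qed.

Theorem theorem2p5 (R : realType) (alpha : R) (k r : nat)
    (halpha1 : 1 < alpha) (halpha2 : alpha < 2)
    (hk : (3 <= k)%N) (hr : (1 <= r)%N) :
  exists C : R, 0 < C /\
    \forall x \near +oo,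
      exists l : R, is_L alpha k r x l /\ l <= C * x `^ (2 - alpha).
Proof.
set e := 2 - alpha.
have e0 : 0 < e by rewrite subr_gt0.
have e1 : 0 < 1 - e by rewrite /e; lra.
set gam := alpha * (alpha - 1).
have gam0 : 0 < gam by rewrite mulr_gt0 //; lra.
have r1 : 1 <= r%:R :> R by rewrite ler1n.
have r0 : 0 < r%:R :> R by lra.
have c0 : 0 < r%:R ^+ 2 * gam by rewrite mulr_gt0 // exprn_gt0.
exists (1 + 8 / gam); split; first by rewrite addr_gt0 // divr_gt0.
near=> x.
have x1 : 1 <= x by near: x; exact: nbhs_pinfty_ge.
have xr : 2 * (1 + 2 * r%:R) <= x by near: x; exact: nbhs_pinfty_ge.
have xk : 256 * k%:R ^+ 2 * (r%:R ^+ 2 * gam) <= x `^ e.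
  by near: x; exact: powR_near_ge.
have xe1 : 1 <= x `^ e by near: x; exact: powR_near_ge.
have xle : 16 / gam <= x `^ (1 - e) by near: x; exact: powR_near_ge.
have x0 : 0 < x by lra.
have /andP[x2e1 x2e2] : x `^ e <= (2 * x) `^ e <= 2 * x `^ e.
  by apply: powR_double; rewrite // (ltW e0) -subr_ge0 ltW.
have y0 : 0 < (2 * x) `^ e by rewrite powR_gt0 // mulr_gt0.
(* The left-hand side bounds the length of the search, so x / 2 remains for
   the rounding of x and the two further steps of a second difference. *)
have reach : 8 / gam * x `^ e <= x / 2.
  have xE : x `^ (1 - e) * x `^ e = x.
    rewrite -powRD; first by rewrite subrK powRr1 // ltW.
    by rewrite subrK oner_eq0.
  have : 16 / gam * x `^ e <= x by rewrite -[leRHS]xE ler_wpM2r // powR_ge0.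
  lra.
set c := r%:R ^+ 2 * gam / (2 * x) `^ e.
have cpos : 0 < c by rewrite mulr_gt0 // invr_gt0.
have cV : c^-1 = (2 * x) `^ e / (r%:R ^+ 2 * gam) by rewrite /c invfM invrK mulrC.
have rc : r%:R * (4 * c^-1) <= 8 / gam * x `^ e.
  have -> : r%:R * (4 * c^-1) = 4 / gam * ((2 * x) `^ e / r%:R).
    by rewrite cV; field; rewrite !gt_eqF.
  have : (2 * x) `^ e / r%:R <= 2 * x `^ e.
    by rewrite ler_pdivrMr // (le_trans x2e2) // ler_peMr // mulr_ge0 // powR_ge0.
  move=> l1.
  have -> : 8 / gam * x `^ e = 4 / gam * (2 * x `^ e) by ring.
  by rewrite ler_wpM2l // divr_ge0 // ltW.
have /andP[N1 N2] := ceil_itv x.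
set N := Num.ceil x in N1 N2.
rewrite intrB in N1.
pose h i : R := (N%:~R + (r * i)%N%:R) `^ alpha.
have nat_ge0 i : 0 <= i%:R :> R by exact: ler0n.
have base_ge i : x <= N%:~R + (r * i)%N%:R :> R.
  by have := nat_ge0 (r * i)%N; lra.
have alpha0 : 0 < alpha by lra.
have [i ic [b [d [b0 d0 fl]]]] : exists2 i : nat, i%:R <= 4 * c^-1 &
    exists b d : int, [/\ 0 < b, 0 < d &
      forall j, (j < k)%N -> Num.floor (h (i + j)%N) = b + d * j%:Z].
  apply: floor_AP_of_second_differences => //.
  - exact: leq_trans hk.
  - by rewrite cV ler_pdivlMr // (le_trans xk).
  - move=> i; rewrite /h -[leLHS](powRr0 (N%:~R + (r * i)%N%:R)).
    by rewrite ler_powR ?(ltW alpha0) // (le_trans x1).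
  - apply: gt0_ltr_powR; rewrite ?nnegrE //; try exact: le_trans (ltW x0) (base_ge _).
    by rewrite ltrD2l ltr_nat muln0 muln1.
  - move=> i ic.
    have step j : N%:~R + (r * j.+1)%N%:R = N%:~R + (r * j)%N%:R + r%:R :> R.
      by rewrite mulnS natrD; ring.
    rewrite /h !step; apply: (powR_second_difference_bounds R alpha x) => //.
      by rewrite halpha1.
    have : r%:R * i%:R <= r%:R * (4 * c^-1) by rewrite ler_pM2l.
    rewrite natrM; lra.
have APn : increasing_AP (floor_powers alpha (k := k) r (N + (r * i)%N%:Z)).
  exists b, d; split=> // j; rewrite /floor_powers -fl ?ltn_ord // /h.
  by rewrite intrD -pmulrn -addrA -natrD -mulnDr.
have xn : x <= (N + (r * i)%N%:Z)%:~R by rewrite intrD -pmulrn.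
have [l [lL ln]] := is_L_le R alpha x k r _ xn APn.
exists l; split=> //; rewrite (le_trans ln) // intrD -pmulrn natrM.
have : r%:R * i%:R <= r%:R * (4 * c^-1) by rewrite ler_pM2l.
lra.
Unshelve. all: by end_near. Qed.
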